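(* Let $p$ be a prime, $G$ a finite group, $S\le G$ a $p$-subgroup (not necessarily Sylow), $\mathcal{F}=\mathcal{F}_S(G)$, and let $B$ be a $\mathbb{Z}$-basis of $R_{\mathbb{C}}(\mathcal{F})$. Let $\rho_S$ denote the regular character of $S$. For $\chi\in\mathrm{Irr}(G)$ write $\mathrm{Res}^G_S(\chi)=\sum_{\psi\in B}d^{B,G}_{\chi\psi}\psi$ with $d^{B,G}_{\chi\psi}\in\mathbb{Z}$, and for $\psi\in B$ let $\Phi^{B,G}_{\psi}:=\sum_{\chi\in\mathrm{Irr}(G)}d^{B,G}_{\chi\psi}\chi\in R_{\mathbb{C}}(G)$. Then $$\rho_S=\sum_{\psi\in B}\frac{\Phi^{B,G}_{\psi}(1)}{[G:S]}\,\psi,$$ and the coefficients $\Phi^{B,G}_{\psi}(1)/[G:S]$ are integers.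
   Context: $\mathcal{F}_S(G)$ is the category whose objects are the subgroups of $S$ and whose morphisms $P\to Q$ are the homomorphisms induced by conjugation by elements of $G$. A class function on $S$ is $\mathcal{F}$-stable if it takes equal values on any two elements of $S$ related by a morphism of $\mathcal{F}$ (here: conjugate in $G$). $R_{\mathbb{C}}(\mathcal{F})$ is the ring of $\mathcal{F}$-stable virtual complex characters of $S$, a free abelian group of finite rank; $R_{\mathbb{C}}(G)$ is the ring of virtual complex characters of $G$. Restrictions to $S$ of characters of $G$ are $\mathcal{F}$-stable, so the integers $d^{B,G}_{\chi\psi}$ exist and are unique. *)

(* Defs.v *)
From HB Require Import structures.
From mathcomp Require Import all_boot all_order all_algebra all_fingroup.
From mathcomp Require Import all_solvable all_field all_character.

Set Implicit Arguments.
Unset Strict Implicit.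
Unset Printing Implicit Defensive.

Import Order.TTheory GRing.Theory Num.Theory.
Local Open Scope ring_scope.

(* The morphisms P -> Q of the category F_S(G). Conjugation is a right action
   here (x ^ g = g^-1 x g); as g runs over G this gives the same morphisms as
   x |-> g x g^-1. *)
Definition fusion_mor (gT : finGroupType) (G S P Q : {group gT})
    (f : {morphism P >-> gT}) : Prop :=
  [/\ P \subset S, Q \subset S, (f @* P)%g \subset Q
    & exists2 g, g \in G & {in P, forall x, f x = (x ^ g)%g}].

Definition fusion_stable (gT : finGroupType) (G S : {group gT})
    (phi : 'CF(S)) : Prop :=
  forall (P Q : {group gT}) (f : {morphism P >-> gT}),
    fusion_mor G S Q f -> {in P, forall x, phi (f x) = phi x}.

(* Membership in R_C(F_S(G)). Over the complex numbers and over algC a finite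
   group has the same characters, and 'Z[irr S] is the library's ring of
   virtual characters. *)
Definition fusion_vchar (gT : finGroupType) (G S : {group gT})
    (phi : 'CF(S)) : Prop :=
  phi \in 'Z[irr S]%g /\ fusion_stable G phi.

Definition zindependent (gT : finGroupType) (S : {group gT})
    (B : seq 'CF(S)) : Prop :=
  uniq B /\
  forall c : 'CF(S) -> int,
    \sum_(psi <- B) psi *~ c psi = 0 -> {in B, forall psi, c psi = 0}.

(* Every Z-basis of R_C(F_S(G)) is finite, hence the use of a sequence. *)
Definition fusion_zbasis (gT : finGroupType) (G S : {group gT})
    (B : seq 'CF(S)) : Prop :=
  zindependent B /\ forall phi : 'CF(S), phi \in 'Z[B]%g <-> fusion_vchar G phi.

(* Only the values of d on Irr(G) x B are constrained, by
   Res^G_S chi = \sum_(psi in B) d_(chi, psi) psi; on that set they are uniquely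
   determined as soon as B is Z-independent. *)
Definition decomposition_numbers (gT : finGroupType) (G S : {group gT})
    (B : seq 'CF(S)) (d : Iirr G -> 'CF(S) -> int) : Prop :=
  forall i, 'Res[S] 'chi[G]_i = \sum_(psi <- B) psi *~ d i psi.

(* The virtual character Phi_psi of G. *)
Definition proj_vchar (gT : finGroupType) (G S : {group gT})
    (d : Iirr G -> 'CF(S) -> int) (psi : 'CF(S)) : 'CF(G) :=
  \sum_i 'chi[G]_i *~ d i psi.

Lemma decomposition_numbers_exist (gT : finGroupType) (G S : {group gT})
    (B : seq 'CF(S)) :
  S \subset G -> fusion_zbasis G B -> exists d, @decomposition_numbers _ G S B d.
Proof.
move=> sSG [[uB _] hB].
have coord i : exists c : {ffun 'I_(size B) -> int},
    'Res[S] 'chi[G]_i == \sum_(j < size B) B`_j *~ c j.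
  have /hB : fusion_vchar G ('Res[S] 'chi[G]_i).
    split; first by rewrite cfRes_vchar ?irr_vchar.
    move=> P Q f [sPS sQS fPQ [g Gg fE]] x Px.
    have Sfx : f x \in S by rewrite (subsetP sQS) ?(subsetP fPQ) ?mem_morphim.
    by rewrite !cfResE ?(subsetP sPS x Px) // fE // cfunJ.
  by case/andP=> _ /sumboolP[c Dc]; exists c; apply/eqP; rewrite Dc.
pose c i := xchoose (coord i).
exists (fun i psi => if insub (index psi B) is Some j then c i j else 0) => i.
rewrite (eqP (xchooseP (coord i))) (big_nth 0) big_mkord.
by apply: eq_bigr => j _; rewrite index_uniq // valK.
Qed.

(* Main.v *)
(* Restrict the regular character of G to S: on one side it is [G : S] rho_S,
   on the other \sum_chi chi(1) Res chi = \sum_psi Phi_psi(1) psi. Since rho_S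
   is itself F-stable it is an integral combination of B, and comparing the two
   expansions of [G : S] rho_S gives the divisibility. *)
Require Import Defs.
From mathcomp Require Import all_boot all_order all_algebra all_fingroup.
From mathcomp Require Import all_solvable all_field all_character.

Import Order.TTheory GRing.Theory Num.Theory.
Local Open Scope ring_scope.

(** Both sides vanish away from the identity, and at the identity Lagrange gives
    [#|G| = #|S| * #|G : S|]. *)
Lemma cfRes_cfReg {gT : finGroupType} {G S : {group gT}} :
  S \subset G -> 'Res[S] (cfReg G) = (#|G : S|%g)%:R *: cfReg S.
Proof.
move=> sSG; apply/cfun_inP => x Sx.
by rewrite cfResE // [RHS]cfunE !cfRegE mulrnAr -natrM mulnC Lagrange.
Qed.

(** The value of [cfReg S] at [x] depends only on whether [x = 1], which conjugation preserves. *)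
Lemma fusion_vchar_cfReg {gT : finGroupType} (G S : {group gT}) :
  fusion_vchar G (cfReg S).
Proof.
split=> [|P Q f [_ _ _ [g _ fE]] x Px]; first exact: char_vchar (cfReg_char S).
by rewrite fE // !cfRegE conjg_eq1.
Qed.

Lemma proj_vchar1 {gT : finGroupType} {G S : {group gT}}
    (d : Iirr G -> 'CF(S) -> int) (psi : 'CF(S)) :
  proj_vchar d psi 1%g = \sum_i 'chi[G]_i 1%g * (d i psi)%:~R.
Proof.
by rewrite sum_cfunE; apply: eq_bigr => i _; rewrite -scaler_int cfunE mulrC.
Qed.

Lemma proj_vchar1_int {gT : finGroupType} {G S : {group gT}}
    (d : Iirr G -> 'CF(S) -> int) (psi : 'CF(S)) :
  proj_vchar d psi 1%g \in Num.int.
Proof.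
rewrite proj_vchar1; apply: rpred_sum => i _.
by apply: rpredM; rewrite ?intr_int ?Cint_vchar1 ?irr_vchar.
Qed.

(** Restrict the sum of the [chi(1) chi], expand each restriction along [B], and interchange the two
    sums. *)
Lemma cfRes_cfReg_decomposition {gT : finGroupType} {G S : {group gT}}
    {B : seq 'CF(S)} {d : Iirr G -> 'CF(S) -> int} :
  decomposition_numbers B d ->
  'Res[S] (cfReg G) = \sum_(psi <- B) proj_vchar d psi 1%g *: psi.
Proof.
move=> hd; rewrite cfReg_sum linear_sum /=.
under eq_bigr => i _ do rewrite linearZ /= hd scaler_sumr.
rewrite exchange_big; apply: eq_bigr => psi _ /=.
rewrite proj_vchar1 scaler_suml; apply: eq_bigr => i _.
by rewrite -scaler_int scalerA.
Qed.

(** Carries independence over [int] to coefficients in [algC] with integral values, the form in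
    which the degrees of the [proj_vchar d psi] occur. *)
Lemma zindependent_eq {gT : finGroupType} {S : {group gT}} {B : seq 'CF(S)}
    {a b : 'CF(S) -> algC} :
  zindependent B -> (forall psi, a psi \in Num.int) ->
  (forall psi, b psi \in Num.int) ->
  \sum_(psi <- B) a psi *: psi = \sum_(psi <- B) b psi *: psi ->
  {in B, a =1 b}.
Proof.
move=> [_ freeB] aZ bZ eq_ab psi Bpsi.
(* The difference is already integral, so [Num.floor] only moves it from [algC] to [int]. *)
pose c chi := Num.floor (a chi - b chi).
have cE chi : (c chi)%:~R = a chi - b chi by rewrite floorK ?rpredB.
apply/eqP; rewrite -subr_eq0 -cE (freeB c) //.
under eq_bigr => chi _ do rewrite -scaler_int cE scalerBl.
by rewrite sumrB eq_ab subrr.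
Qed.

Theorem theoremD (gT : finGroupType) (p : nat) (G S : {group gT})
    (B : seq 'CF(S)) (d : Iirr G -> 'CF(S) -> int)
    (p_prime : prime p) (sSG : S \subset G) (pS : (p.-group S)%g)
    (hB : fusion_zbasis G B) (hd : decomposition_numbers B d) :
  cfReg S
    = \sum_(psi <- B) (proj_vchar d psi 1%g / (#|G : S|%g)%:R) *: psi
  /\ {in B, forall psi, proj_vchar d psi 1%g / (#|G : S|%g)%:R \in Num.int}.
Proof.
have iGS_neq0 : (#|G : S|%g)%:R != 0 :> algC by rewrite pnatr_eq0 -lt0n.
have regE := cfRes_cfReg sSG.
rewrite (cfRes_cfReg_decomposition hd) in regE.
split.
  (* Multiplying by the nonzero index turns the claim into [regE]. *)
  apply: (scalerI iGS_neq0); rewrite -regE scaler_sumr.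
  by apply: eq_bigr => psi _; rewrite scalerA mulrC divfK.
case: hB => freeB spanB.
have /spanB/(zchar_expansion (proj1 freeB))[c cZ regS] := fusion_vchar_cfReg G S.
move: regE; rewrite regS scaler_sumr.
under [RHS]eq_bigr => psi _ do rewrite scalerA.
move=> eqB psi Bpsi.
(* Comparing coefficients at [psi] gives that [proj_vchar d psi 1] is the index times the integer
   [c psi]. *)
rewrite (zindependent_eq freeB _ _ eqB psi Bpsi) => [|chi|chi].
- by rewrite mulrC mulKf.
- exact: proj_vchar1_int.
- by rewrite rpredM ?rpred_nat.
Qed.
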